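(* Let $C$ be an optimal LRC over $\mathbb{F}_q$ with locality $r\ge 1$, length $n$ divisible by $r+1$, dimension $k$ and minimum distance $d$ (so $d=n-k-\lceil k/r\rceil+2$). Then $$d\ \le\ q\,\frac{r^2+2r+3}{r}.$$
   Context: All codes are linear. For a code $C\subseteq \mathbb{F}_q^n$, an index $i\in\{1,\dots,n\}$ and $\alpha\in\mathbb{F}_q$, let $C(i,\alpha)=\{(c_1,\dots,c_n)\in C : c_i=\alpha\}$, and for $I\subseteq\{1,\dots,n\}\setminus\{i\}$ let $C_I(i,\alpha)$ be the projection of $C(i,\alpha)$ on the coordinates in $I$. A set $R\subseteq\{1,\dots,n\}$ containing $i$ is a recovery set for $i$ if $C_{R\setminus\{i\}}(i,\alpha)\cap C_{R\setminus\{i\}}(i,\beta)=\emptyset$ for all $\alpha\ne\beta$ in $\mathbb{F}_q$. The code $C$ is a locally repairable code (LRC) with locality $r$ if every $i\in\{1,\dots,n\}$ has a recovery set of size $r+1$. Every linear LRC of length $n$, dimension $k$, minimum distance $d$ and locality $r$ satisfies the Singleton-type bound $d\le n-k-\lceil k/r\rceil+2$; it is called optimal if equality holds.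
   Formalization: The dimension is assumed to satisfy k ≥ 2; for k = 1 the claim fails, e.g. the binary repetition code with r = 1, n = 14 is optimal with d = 14 > 12, and for k = 0 there is no minimum distance. *)

(* Defs.v *)
From HB Require Import structures.
From mathcomp Require Import all_boot all_order all_algebra.

Set Implicit Arguments.
Unset Strict Implicit.
Unset Printing Implicit Defensive.

Import Order.TTheory GRing.Theory Num.Theory.
Local Open Scope ring_scope.

(* A linear code of length n over F is a subspace C : {vspace 'rV[F]_n};
   coordinates are indexed by 'I_n. *)

Definition hamming_dist (F : finFieldType) (n : nat) (x y : 'rV[F]_n) : nat :=
  #|[set i : 'I_n | x 0 i != y 0 i]|.

(* Relational, since the zero code has no minimum distance. *)
Definition is_min_dist (F : finFieldType) (n : nat)
    (C : {vspace 'rV[F]_n}) (d : nat) : Prop :=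
  (exists x y : 'rV[F]_n,
     [/\ x \in C, y \in C, x != y & hamming_dist x y = d]) /\
  (forall x y : 'rV[F]_n,
     x \in C -> y \in C -> x != y -> (d <= hamming_dist x y)%N).

Definition coord_proj (F : finFieldType) (n : nat) (I : {set 'I_n})
    (c : 'rV[F]_n) : 'rV[F]_#|I| :=
  \row_(j < #|I|) c 0 (enum_val j).

(* C(i, alpha) *)
Definition slice (F : finFieldType) (n : nat) (C : {vspace 'rV[F]_n})
    (i : 'I_n) (alpha : F) : {set 'rV[F]_n} :=
  [set c : 'rV[F]_n | (c \in C) && (c 0 i == alpha)].

(* C_I(i, alpha) *)
Definition proj_slice (F : finFieldType) (n : nat) (C : {vspace 'rV[F]_n})
    (I : {set 'I_n}) (i : 'I_n) (alpha : F) : {set 'rV[F]_#|I|} :=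
  [set coord_proj I c | c in slice C i alpha].

Definition recovery_set (F : finFieldType) (n : nat) (C : {vspace 'rV[F]_n})
    (i : 'I_n) (R : {set 'I_n}) : Prop :=
  i \in R /\
  forall alpha beta : F, alpha != beta ->
    proj_slice C (R :\ i) i alpha :&: proj_slice C (R :\ i) i beta = set0.

Definition has_locality (F : finFieldType) (n : nat) (C : {vspace 'rV[F]_n})
    (r : nat) : Prop :=
  forall i : 'I_n, exists R : {set 'I_n}, #|R| = r.+1 /\ recovery_set C i R.

(* The equality is over int, so the subtractions are not truncated. *)
Definition optimal_lrc (F : finFieldType) (n : nat) (C : {vspace 'rV[F]_n})
    (r k d : nat) : Prop :=
  [/\ has_locality C r, \dim C = k, is_min_dist C d &
      d%:Z = n%:Z - k%:Z - Num.ceil (k%:R / r%:R : rat) + 2].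

(* Main.v *)
(* Shorten C on a union S of repair groups, chosen greedily: each group costs at
   most r dimensions, and its redundant coordinate comes for free.  With
   floor((k-2)/r) groups, padded by further single coordinates, one gets a
   subcode of dimension at least 2 that vanishes on S, where optimality of C
   forces n - |S| <= d + 2.  If u, v are independent words of this subcode, then
   among the q + 1 words u and v + a u at least one vanishes at any given
   coordinate, so (q + 1) d <= q (n - |S|) <= q (d + 2), that is d <= 2 q, which is
   stronger than the claimed bound. *)
Require Import Defs.
From HB Require Import structures.
From mathcomp Require Import all_boot all_order all_algebra.
From mathcomp Require Import zify lra.

Set Implicit Arguments.
Unset Strict Implicit.
Unset Printing Implicit Defensive.

Import Order.TTheory GRing.Theory Num.Theory.
Local Open Scope ring_scope.

Section Shortening.
Variables (F : finFieldType) (n : nat).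
Implicit Types (C D : {vspace 'rV[F]_n}) (S A R : {set 'I_n}) (c u v : 'rV[F]_n).

Definition vanishes_on D S := forall c i, c \in D -> i \in S -> c 0 i = 0.

Lemma coord_proj_linear A : linear (@coord_proj F n A).
Proof. by move=> a c c'; apply/rowP => j; rewrite !mxE. Qed.

HB.instance Definition _ A :=
  GRing.isLinear.Build F 'rV[F]_n 'rV[F]_#|A| _ (@coord_proj F n A)
    (coord_proj_linear A).

(** The zero coordinates are kept rather than deleted, so that repeated shortenings remain subcodes
    of [C] and inherit its distance bound. *)
Definition shortened D A : {vspace 'rV[F]_n} :=
  (D :&: lker (linfun (@coord_proj F n A)))%VS.

Lemma shorten_sub D A : (shortened D A <= D)%VS.
Proof. exact: capvSl. Qed.

Lemma shorten_vanishes D A : vanishes_on (shortened D A) A.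
Proof.
move=> c i; rewrite memv_cap memv_ker lfunE /= => /andP[_ /eqP c0] iA.
move/rowP: c0 => /(_ (enum_rank_in iA i)).
by rewrite !mxE enum_rankK_in.
Qed.

Lemma dim_shorten D A : (\dim D <= \dim (shortened D A) + #|A|)%N.
Proof.
rewrite -(limg_ker_dim (linfun (@coord_proj F n A)) D) leq_add2l.
by apply: leq_trans (dimvS (subvf _)) _; rewrite dimvf /dim /= mul1n.
Qed.

Lemma vanishes_onU D S A :
  vanishes_on D S -> vanishes_on (shortened D A) (S :|: A).
Proof.
move=> DS c i cD; rewrite inE => /orP[]; last exact: shorten_vanishes cD.
exact: DS (subvP (shorten_sub D A) _ cD).
Qed.

Lemma exists_notin_support D S :
  vanishes_on D S -> (0 < \dim D)%N -> exists i, i \notin S.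
Proof.
move=> DS; rewrite lt0n dimv_eq0 -vpick0 => /rV0Pn[i ci].
by exists i; apply: contra ci => /(DS _ _ (memv_pick D)) ->.
Qed.

(** Otherwise [c] and the zero word lie in different slices at [i] but have the same projection,
    zero, on [R :\ i]. *)
Lemma recovery_set_eq0 C i R c :
  recovery_set C i R -> c \in C -> (forall j, j \in R :\ i -> c 0 j = 0) ->
  c 0 i = 0.
Proof.
move=> [_ rec] cC c0; apply/eqP; case: eqVneq => // ci.
have /setP/(_ 0) := rec _ _ ci; rewrite !inE => /negP[]; apply/andP; split.
  apply/imsetP; exists c; first by rewrite inE cC eqxx.
  by apply/rowP => j; rewrite !mxE c0 //; apply: enum_valP.
apply/imsetP; exists 0; first by rewrite inE mem0v mxE eqxx.
by apply/rowP => j; rewrite !mxE.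
Qed.

(** Imposing zeros on the rest of a repair group of some [i] outside [S] costs at most [r]
    dimensions, and recovery then forces a zero at [i] too: this extra coordinate makes the last
    inequality strict. *)
Lemma shorten_repair_group C D S r :
  has_locality C r -> (D <= C)%VS -> vanishes_on D S -> (0 < \dim D)%N ->
  exists D' S', [/\ (D' <= C)%VS, vanishes_on D' S',
    (\dim D <= \dim D' + r)%N & (\dim D + #|S| < \dim D' + #|S'|)%N].
Proof.
move=> loc DC DS D0; have [i iS] := exists_notin_support DS D0.
have [R [cR recR]] := loc i; have iR := recR.1.
pose A := (R :\ i) :\: S.
have iSA : i \notin S :|: A by rewrite !inE eqxx (negPf iS) andbF.
have D'C : (shortened D A <= C)%VS := subv_trans (shorten_sub D A) DC.
have DA := vanishes_onU (A := A) DS.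
have leA : (#|A| <= r)%N.
  apply: leq_trans (subset_leq_card (subsetDl _ _)) _.
  by rewrite (cardsD1 i) iR in cR; lia.
have dA := dim_shorten D A.
have SA0 : S :&: A = set0 by rewrite setIDA setIC setDIl setDv setI0.
have cSA : #|S :|: A| = (#|S| + #|A|)%N by rewrite cardsU SA0 cards0 subn0.
exists (shortened D A), (i |: (S :|: A)); split=> //.
- move=> c j cD; rewrite in_setU1 => /predU1P[->|]; last exact: DA.
  apply: (recovery_set_eq0 recR (subvP D'C _ cD)) => l lR.
  by apply: DA cD _; rewrite in_setU in_setD lR andbT orbN.
- by lia.
- by rewrite cardsU1 iSA cSA; lia.
Qed.

Lemma shorten_repair_groups C r j :
  has_locality C r -> (j * r < \dim C)%N ->
  exists D S, [/\ (D <= C)%VS, vanishes_on D S,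
    (\dim C <= \dim D + j * r)%N & (\dim C + j <= \dim D + #|S|)%N].
Proof.
move=> loc; elim: j => [|j IHj] jr.
  exists C, set0; split=> //; rewrite ?cards0; try lia.
  by move=> c i _; rewrite inE.
have [|D [S [DC DS dD dS]]] := IHj; first by lia.
have [|D' [S' [D'C D'S' dD' dS']]] := shorten_repair_group loc DC DS; first by lia.
by exists D', S'; split=> //; lia.
Qed.

Lemma shorten_to_dim2 C D S :
  (D <= C)%VS -> vanishes_on D S -> (2 <= \dim D)%N ->
  exists D' S', [/\ (D' <= C)%VS, vanishes_on D' S', (2 <= \dim D')%N
    & (\dim D + #|S| <= #|S'| + 2)%N].
Proof.
(* Each round enlarges [S] and never raises the dimension, so this measure drops even if the chosen
   coordinate already vanishes on [D]. *)
have [m] := ubnP (\dim D + (n - #|S|)); elim: m D S => // m IHm D S lem DC DS D2.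
have [D3|D3] := leqP (\dim D) 2; first by exists D, S; split=> //; lia.
have [|i iS] := exists_notin_support DS; first by lia.
have := dim_shorten D [set i]; rewrite cards1 => dD.
have dD' := dimvS (shorten_sub D [set i]).
have cS : #|S :|: [set i]| = #|S|.+1 by rewrite setUC cardsU1 iS.
have leS : (#|S :|: [set i]| <= n)%N by rewrite -[leqRHS]card_ord max_card.
have [||||D' [S' [D'C D'S' D'2 dS']]] := IHm (shortened D [set i]) (S :|: [set i]).
- by lia.
- exact: subv_trans (shorten_sub _ _) DC.
- exact: vanishes_onU.
- by lia.
by exists D', S'; split=> //; lia.
Qed.

Lemma hamming_dist0 c : hamming_dist c 0 = (\sum_i (c 0%R i != 0%R))%N.
Proof.
rewrite /hamming_dist -sum1dep_card big_mkcond /=.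
by apply: eq_bigr => i _; rewrite mxE; case: eqP.
Qed.

Lemma plotkin_dim2 D S d :
  vanishes_on D S -> (2 <= \dim D)%N ->
  (forall c, c \in D -> c != 0 -> (d <= hamming_dist c 0)%N) ->
  (#|F|.+1 * d <= (n - #|S|) * #|F|)%N.
Proof.
move=> DS D2 dmin.
have uD := memv_pick D; set u := vpick D in uD.
have u0 : u != 0 by rewrite vpick0 -dimv_eq0; lia.
have /subvPn[v vD vu] : ~~ (D <= <[u]>)%VS.
  by apply: contraL D2 => /dimvS; rewrite dim_vline u0; lia.
(* [option F] plays the projective line, with [None] as the point at infinity: [w] picks one nonzero
   word from each of the q + 1 lines in the span of [u] and [v]. *)
pose w (o : option F) := if o is Some a then v + a *: u else u.
have wD o : w o \in D by case: o => [a|] //=; rewrite rpredD ?rpredZ.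
have w0 o : w o != 0.
  case: o => [a|] //=; apply: contra vu; rewrite addr_eq0 => /eqP->.
  by rewrite rpredN rpredZ ?memv_line.
have wi i : (\sum_o (w o 0%R i != 0%R) <= (i \notin S) * #|F|)%N.
  have [iS|_] := boolP (i \in S).
    by rewrite big1 // => o _; rewrite (DS _ _ (wD o) iS) eqxx.
  (* A linear form on a plane has a zero on the projective line. *)
  have [o wo] : exists o, w o 0 i = 0.
    have [ui|ui] := eqVneq (u 0 i) 0; first by exists None.
    by exists (Some (- (v 0 i / u 0 i))); rewrite !mxE mulNr divfK // subrr.
  rewrite (bigD1 o) //= wo eqxx add0n mul1n.
  apply: leq_trans (leq_sum _ (fun _ _ => leq_b1 _)) _.
  by rewrite sum1_card cardC1 card_option.
have -> : (#|F|.+1 * d = \sum_(o : option F) d)%N.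
  by rewrite sum_nat_const card_option.
apply: leq_trans (leq_sum _ (fun o _ => dmin _ (wD o) (w0 o))) _.
under eq_bigr do rewrite hamming_dist0.
rewrite exchange_big /=; apply: leq_trans (leq_sum _ (fun i _ => wi i)) _.
have -> : (n - #|S| = #|~: S|)%N by rewrite [RHS]cardsCs setCK card_ord.
rewrite -big_distrl /=; suff -> : (\sum_i (i \notin S) = #|~: S|)%N by [].
by rewrite -sum1_card [RHS]big_mkcond; apply: eq_bigr => i _; rewrite inE; case: ifP.
Qed.

End Shortening.

Lemma ceil_ratio_le (k r m : nat) : (0 < r)%N -> (k <= m * r)%N ->
  Num.ceil (k%:R / r%:R : rat) <= m%:Z.
Proof.
move=> r0 km; rewrite ceil_le_int ler_pdivrMr ?ltr0n //.
by rewrite -natrM ler_nat.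
Qed.

(** Repetition codes of any length n > r are optimal with k = 1 and d = n, hence the assumption on
    [k]. *)
Lemma optimal_lrc_dist_le (F : finFieldType) (n r k d : nat)
    (C : {vspace 'rV[F]_n}) :
  (1 <= r)%N -> (2 <= k)%N -> optimal_lrc C r k d -> (d <= 2 * #|F|)%N.
Proof.
move=> r1 k2 [loc dimC [_ dmin] dE].
(* The largest number of groups that is sure to leave dimension at least 2; it still satisfies
   ceil(k/r) <= j + 2. *)
pose j := ((k - 2) %/ r)%N.
have jr : (j * r <= k - 2)%N := leq_divM _ _.
have kj : (k <= (j + 2) * r)%N.
  by have := ltn_ceil (k - 2) r1; rewrite -/j; nia.
have leceil := ceil_ratio_le r1 kj.
have [|D [S [DC DS dD dS]]] := shorten_repair_groups (j := j) loc; first by lia.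
have [|D' [S' [D'C D'S' D'2 dS']]] := shorten_to_dim2 DC DS; first by lia.
have plotkin : (#|F|.+1 * d <= (n - #|S'|) * #|F|)%N.
  apply: plotkin_dim2 D'S' D'2 _ => c cD c0.
  by apply: dmin; rewrite ?mem0v ?(subvP D'C).
(* The shortenings give |S'| >= k + j - 2, while optimality and the bound on the ceiling give d >= n
   - k - j. *)
have : (n - #|S'| <= d + 2)%N by lia.
by nia.
Qed.

Theorem theorem3p3 (F : finFieldType) (n r k d : nat) (C : {vspace 'rV[F]_n})
    (r_ge1 : (1 <= r)%N) (k_ge2 : (2 <= k)%N) (r1_dvd_n : (r.+1 %| n)%N)
    (C_opt : optimal_lrc C r k d) :
  (d%:R : rat) <= #|F|%:R * ((r%:R ^+ 2 + 2 * r%:R + 3) / r%:R).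
Proof.
have le2q := optimal_lrc_dist_le r_ge1 k_ge2 C_opt.
(* The factor of q in the claim is r + 2 + 3/r, which exceeds 2. *)
apply: (@le_trans _ _ (#|F|%:R * 2)); first by rewrite -natrM ler_nat mulnC.
apply: ler_wpM2l; first exact: ler0n.
rewrite ler_pdivlMr ?ltr0n //.
by have := sqr_ge0 (r%:R : rat); lra.
Qed.
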